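(* In the setting given in the context, for every $\kappa\in\mathcal{K}^\bullet$, $$I(\kappa)=\|m^\bullet\|_1+\sum_{i=1}^n\frac{[\sigma_i+\omega_i\kappa_i]_+}{\sqrt{1+\kappa_i^2}},$$ where $[x]_+=\max\{x,0\}$. Moreover, the worst-case realizations, i.e. the maximizers $p^{\mathrm{wc}}$ of $p\mapsto\tilde w(p,\kappa)$ over $\mathcal{P}(\kappa)$, are characterized componentwise: $p^{\mathrm{wc}}\in\mathbb{R}^n$ is a maximizer if and only if for every $i\in\{1,\dots,n\}$, $$p_i^{\mathrm{wc}}\ \begin{cases}=\dfrac{1}{\sqrt{1+\kappa_i^2}}, & \text{if }\sigma_i+\omega_i\kappa_i>0,\\[2mm] =0, & \text{if }\sigma_i+\omega_i\kappa_i<0,\\[1mm] \in\left[0,\dfrac{1}{\sqrt{1+\kappa_i^2}}\right]\ (\text{any value}), & \text{if }\sigma_i+\omega_i\kappa_i=0.\end{cases}$$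
   Context: Let $n\ge 1$, and let $R,X\in\mathbb{R}^{n\times n}$ be arbitrary fixed matrices. Let $\underline{m},\overline{m},m^\bullet\in\mathbb{R}^n$ satisfy $\underline{m}\le 0\le\overline{m}$ and $\underline{m}\le m^\bullet\le\overline{m}$ componentwise, and let $\underline{\alpha}\in\mathbb{R}^n$ with $0<\underline{\alpha}_i\le 1$ for all $i$. Vector inequalities are componentwise, and $\operatorname{sign}$ takes values in $\{-1,0,1\}$ with $\operatorname{sign}(0)=0$, applied componentwise to vectors. Let $\mathcal{P}\triangleq[0,1]^n$. For $\kappa\in\mathbb{R}^n$ set $\tilde S(\kappa)\triangleq R+X\operatorname{diag}(\kappa)$ and $\mathcal{P}(\kappa)\triangleq\prod_{i=1}^n\left[0,\frac{1}{\sqrt{1+\kappa_i^2}}\right]$. Define $$\mathcal{K}\triangleq\left\{\kappa\in\mathbb{R}^n:\ |\kappa_i|\le\frac{\sqrt{1-\underline{\alpha}_i^2}}{\underline{\alpha}_i}\ \forall i,\ \ \underline{m}\le\tilde S(\kappa)p'\le\overline{m}\ \ \forall p'\in\mathcal{P}\right\}.$$ For $\kappa\in\mathcal{K}$ and $p\in\mathcal{P}(\kappa)$ let $\tilde w(p,\kappa)\triangleq\|m^\bullet-\tilde S(\kappa)p\|_1$ and $I(\kappa)\triangleq\max_{p\in\mathcal{P}(\kappa)}\tilde w(p,\kappa)$. Let $s^\bullet\triangleq\operatorname{sign}(m^\bullet)$, and for $\kappa\in\mathcal{K}$ let $\mathcal{R}_{s^\bullet}(\kappa)\triangleq\{p\in\mathcal{P}(\kappa):\operatorname{sign}(m^\bullet-\tilde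 S(\kappa)p)=s^\bullet\}$. Define $\mathcal{K}^\bullet\triangleq\{\kappa\in\mathcal{K}:\mathcal{P}(\kappa)=\overline{\mathcal{R}_{s^\bullet}(\kappa)}\}$, where the overline denotes closure in $\mathbb{R}^n$. Finally, $\sigma\triangleq-R^\top s^\bullet$ and $\omega\triangleq-X^\top s^\bullet$. *)

(* Defs.v *)
From HB Require Import structures.
From mathcomp Require Import all_boot all_order all_algebra.
From mathcomp Require Import all_classical all_reals all_analysis.

Set Implicit Arguments.
Unset Strict Implicit.
Unset Printing Implicit Defensive.

Import Order.TTheory GRing.Theory Num.Theory.
Import numFieldNormedType.Exports.

Local Open Scope classical_set_scope.
Local Open Scope ring_scope.

(* Vectors of R^n are column vectors ['cV[F]_n], with F the field of real
   numbers; [v i 0] is the i-th component of v. *)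

Definition l1norm (F : realType) (n : nat) (v : 'cV[F]_n) : F :=
  \sum_(i < n) `|v i 0|.

Definition sign_vec (F : realType) (n : nat) (v : 'cV[F]_n) : 'cV[F]_n :=
  map_mx (@Num.sg F) v.

Definition pospart (F : realType) (x : F) : F := Num.max x 0.

(* The greatest element of the set of values of f on A; the default value 0 is
   returned only if this set has no greatest element. *)
Definition max_over (F : realType) (T : Type) (A : set T) (f : T -> F) : F :=
  xget 0 (f @` A `&` ubound (f @` A)).

Definition maximizer (F : realType) (T : Type) (A : set T) (f : T -> F)
    (p : T) : Prop :=
  A p /\ forall q, A q -> f q <= f p.

Definition Stilde (F : realType) (n : nat) (R X : 'M[F]_n) (kappa : 'cV[F]_n) :
    'M[F]_n :=
  R + X *m diag_mx kappa^T.

Definition unit_box (F : realType) (n : nat) : set 'cV[F]_n :=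
  [set p : 'cV[F]_n | forall i, 0 <= p i 0 <= 1].

Definition Pcap (F : realType) (n : nat) (kappa : 'cV[F]_n) (i : 'I_n) : F :=
  1 / Num.sqrt (1 + kappa i 0 ^+ 2).

Definition Pbox (F : realType) (n : nat) (kappa : 'cV[F]_n) : set 'cV[F]_n :=
  [set p : 'cV[F]_n | forall i, 0 <= p i 0 <= Pcap kappa i].

Definition Kset (F : realType) (n : nat) (R X : 'M[F]_n)
    (mlo mhi alpha : 'cV[F]_n) : set 'cV[F]_n :=
  [set kappa : 'cV[F]_n |
    (forall i, `|kappa i 0| <= Num.sqrt (1 - alpha i 0 ^+ 2) / alpha i 0) /\
    (forall p : 'cV[F]_n, unit_box p -> forall i,
       mlo i 0 <= (Stilde R X kappa *m p) i 0 <= mhi i 0)].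

Definition wtilde (F : realType) (n : nat) (R X : 'M[F]_n) (mb : 'cV[F]_n)
    (p kappa : 'cV[F]_n) : F :=
  l1norm (mb - Stilde R X kappa *m p).

Definition Imax (F : realType) (n : nat) (R X : 'M[F]_n) (mb : 'cV[F]_n)
    (kappa : 'cV[F]_n) : F :=
  max_over (Pbox kappa) (fun p : 'cV[F]_n => wtilde R X mb p kappa).

Definition Rset (F : realType) (n : nat) (R X : 'M[F]_n) (mb : 'cV[F]_n)
    (kappa : 'cV[F]_n) : set 'cV[F]_n :=
  [set p : 'cV[F]_n | Pbox kappa p /\
     sign_vec (mb - Stilde R X kappa *m p) = sign_vec mb].

(* [closure] is taken in the topology of entrywise convergence on 'cV[F]_n,
   i.e. the Euclidean topology of R^n. *)
Definition Kbullet (F : realType) (n : nat) (R X : 'M[F]_n)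
    (mlo mhi mb alpha : 'cV[F]_n) : set 'cV[F]_n :=
  [set kappa : 'cV[F]_n | Kset R X mlo mhi alpha kappa /\
     Pbox kappa = closure (Rset R X mb kappa)].

Definition sigma_vec (F : realType) (n : nat) (R : 'M[F]_n) (mb : 'cV[F]_n) :
    'cV[F]_n :=
  - (R^T *m sign_vec mb).

Definition omega_vec (F : realType) (n : nat) (X : 'M[F]_n) (mb : 'cV[F]_n) :
    'cV[F]_n :=
  - (X^T *m sign_vec mb).

(* Main.v *)
(** On the region where [sign (mb - S p) = sign mb], the l1 norm of [mb - S p]
    is the affine function [l1norm mb + \sum_j (sigma_j + omega_j kappa_j) p_j]
    of [p]. Both sides are continuous, so they agree on the closure of this
    region, which is the whole box when [kappa] is in [Kbullet]. Maximizing the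
    affine function over the box is then a separate problem in each
    coordinate. *)
Require Import Defs.
From HB Require Import structures.
From mathcomp Require Import all_boot all_order all_algebra.
From mathcomp Require Import all_classical all_reals all_analysis.

Set Implicit Arguments.
Unset Strict Implicit.
Unset Printing Implicit Defensive.

Import Order.TTheory GRing.Theory Num.Theory.
Import numFieldNormedType.Exports.

Local Open Scope classical_set_scope.
Local Open Scope ring_scope.

Section BoxMaximization.
Variable F : realType.

Lemma mul_le_pospart (c x b : F) : 0 <= x <= b -> c * x <= pospart c * b.
Proof.
case/andP=> x0 xb; rewrite /pospart; apply: (@le_trans _ _ (Num.max c 0 * x)).
  by rewrite ler_wpM2r // le_max lexx.
by rewrite ler_wpM2l // le_max lexx orbT.
Qed.

(** Equality case of the one-coordinate problem. For [c > 0] the factor [c] cancels; for [c < 0] the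
    right side is 0, which forces [x = 0]; for [c = 0] both sides vanish and only the bounds on [x]
    remain. *)
Lemma mul_eq_pospart (c x b : F) : 0 <= b ->
  (0 <= x <= b /\ c * x = pospart c * b) <->
  [/\ 0 < c -> x = b, c < 0 -> x = 0 & c = 0 -> 0 <= x <= b].
Proof.
rewrite /pospart => b0; case: (ltgtP c 0) => c0; split.
- case=> _ /eqP; rewrite mul0r mulf_eq0 (lt_eqF c0) /= => /eqP x0.
  by split=> // /eqP; rewrite (lt_eqF c0).
- by case=> _ -> // _; rewrite lexx b0 mulr0 mul0r.
- by case=> _ /(mulfI (lt0r_neq0 c0)) ->; split=> // _; rewrite lexx b0.
- by case=> -> // _ _; rewrite lexx b0.
- by case.
- by case=> _ _ H; split; [exact: H|rewrite c0 !mul0r].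
Qed.

(** The differences [g i - f i] are nonnegative and sum to 0, so each of them is 0. *)
Lemma sum_eq_termwise (I : finType) (f g : I -> F) :
  (forall i, f i <= g i) -> \sum_i f i = \sum_i g i -> forall i, f i = g i.
Proof.
move=> fg /eqP; rewrite eq_sym -subr_eq0 -sumrB psumr_eq0; last first.
  by move=> i _; rewrite subr_ge0.
by move=> /allP H i; apply/eqP; rewrite eq_sym -subr_eq0; apply: H;
  rewrite mem_index_enum.
Qed.

(** A greatest value is unique, so the choice made by [xget] must be [f x]; the default 0 is
    excluded because [f x] itself qualifies. *)
Lemma max_overE (T : Type) (A : set T) (f : T -> F) (x : T) :
  maximizer A f x -> max_over A f = f x.
Proof.
case=> Ax xmax; rewrite /max_over; case: xgetP => [y _|/(_ (f x))]; last first.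
  by case; split; [exists x | move=> _ [q Aq <-]; exact: xmax].
case=> -[z Az <-] zub; apply/eqP; rewrite eq_le xmax //=.
by apply: zub; exists x.
Qed.

End BoxMaximization.

Section WorstCase.
Variables (F : realType) (n : nat) (R X : 'M[F]_n) (mb kappa : 'cV[F]_n).

Let slope (j : 'I_n) : F :=
  sigma_vec R mb j 0 + omega_vec X mb j 0 * kappa j 0.

(** An exchange of two finite sums, valid for every [p]: the sign condition only enters when the
    left side is identified with the l1 norm. *)
Lemma sum_sign_residual (p : 'cV[F]_n) :
  \sum_i Num.sg (mb i 0) * (mb - Stilde R X kappa *m p) i 0 =
  l1norm mb + \sum_j slope j * p j 0.
Proof.
(* [t i j] is the signed contribution of entry [(i, j)] of [Stilde]; its column sums give the
   slopes, up to sign, and its row sums give the residual. *)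
pose t i j := Num.sg (mb i 0) * (R i j + X i j * kappa j 0) * p j 0.
have slopeE j : slope j * p j 0 = - \sum_i t i j.
  rewrite /slope /sigma_vec /omega_vec !mxE mulNr -opprD mulNr; congr (- _).
  rewrite mulr_suml -big_split mulr_suml; apply: eq_bigr => i _ /=.
  by rewrite !mxE /t mulrDr !mulrA [R i j * _]mulrC [X i j * _]mulrC.
rewrite (eq_bigr _ (fun j _ => slopeE j)) sumrN exchange_big /= -sumrB.
apply: eq_bigr => i _; rewrite !mxE mulrBr -normrEsg mulr_sumr.
by congr (_ - _); apply: eq_bigr => j _; rewrite /Stilde mul_mx_diag !mxE mulrA.
Qed.

Lemma residual_continuous (i : 'I_n) :
  continuous (fun p : 'cV[F]_n => (mb - Stilde R X kappa *m p) i 0).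
Proof.
rewrite [f in continuous f](_ : _ = fun q : 'cV[F]_n =>
    mb i 0 - \sum_j Stilde R X kappa i j * q j 0); last first.
  by apply/funext => q; rewrite !mxE.
have cS : continuous (fun q : 'cV[F]_n => \sum_j Stilde R X kappa i j * q j 0).
  apply: continuous_big => [|j _ p]; first exact: add_continuous.
  by apply: continuousM; [exact: cst_continuous | exact: coord_continuous].
by move=> p; apply: continuousB; [exact: cst_continuous | exact: cS].
Qed.

Lemma norm_residual_closure (p : 'cV[F]_n) (i : 'I_n) :
  closure (Rset R X mb kappa) p ->
  `|(mb - Stilde R X kappa *m p) i 0| =
  Num.sg (mb i 0) * (mb - Stilde R X kappa *m p) i 0.
Proof.
pose r (q : 'cV[F]_n) := (mb - Stilde R X kappa *m q) i 0.
(* The claim says that [g p = 0]. The zero set of the continuous [g] is closed and contains [Rset],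
   hence also its closure. *)
pose g q : F := `|r q| - Num.sg (mb i 0) * r q.
have cg : continuous g.
  have cr : continuous r by exact: residual_continuous.
  move=> q; apply: (@continuousB _ _ _ (fun q => `|r q|)).
    exact: (continuous_comp (cr q) (@norm_continuous _ _ _)).
  by apply: continuousM; [exact: cst_continuous | exact: cr].
have clg : closed (g @^-1` [set 0]).
  by apply: closed_comp => [q _|]; [exact: cg|exact: closed_eq].
have Rg : Rset R X mb kappa `<=` g @^-1` [set 0].
  move=> q [_ /matrixP/(_ i 0)]; rewrite !mxE /= => sgE.
  by rewrite /g /r -sgE !mxE -normrEsg subrr.
move=> /(closureS Rg); rewrite -(closure_id _).1 // => /eqP.
by rewrite /g subr_eq0 => /eqP.
Qed.

Hypothesis box_closure : Pbox kappa = closure (Rset R X mb kappa).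

Lemma wtilde_affine (p : 'cV[F]_n) : Pbox kappa p ->
  wtilde R X mb p kappa = l1norm mb + \sum_j slope j * p j 0.
Proof.
rewrite box_closure => clp; rewrite -sum_sign_residual.
by apply: eq_bigr => i _; exact: norm_residual_closure.
Qed.

Lemma Pcap_ge0 (i : 'I_n) : 0 <= Pcap kappa i.
Proof. by rewrite divr_ge0 // sqrtr_ge0. Qed.

Let worst := l1norm mb + \sum_j pospart (slope j) * Pcap kappa j.

(** A point of the box where the bound [worst] is attained; the value 0 at zero slope is an
    arbitrary choice. *)
Let vertex : 'cV[F]_n := \col_j (if 0 < slope j then Pcap kappa j else 0).

Let wtilde_le_worst (p : 'cV[F]_n) : Pbox kappa p ->
  wtilde R X mb p kappa <= worst.
Proof.
move=> pP; rewrite wtilde_affine // lerD2l.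
by apply: ler_sum => j _; exact: mul_le_pospart.
Qed.

(** The bound is a sum of coordinatewise bounds, so it is attained exactly when every coordinate
    attains its own. *)
Let wtilde_eq_worst (p : 'cV[F]_n) :
  (Pbox kappa p /\ wtilde R X mb p kappa = worst) <->
  forall j, [/\ 0 < slope j -> p j 0 = Pcap kappa j,
                slope j < 0 -> p j 0 = 0
              & slope j = 0 -> 0 <= p j 0 <= Pcap kappa j].
Proof.
split=> [[pP]|H].
  rewrite wtilde_affine // => /addrI /sum_eq_termwise eqp j.
  apply/mul_eq_pospart; first exact: Pcap_ge0.
  by split; [exact: pP | apply: eqp => k; exact: mul_le_pospart].
(* The three cases also yield membership in the box, which is required before the affine formula
   applies. *)
have {}H j := (mul_eq_pospart (slope j) (p j 0) (Pcap_ge0 j)).2 (H j).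
have pP : Pbox kappa p by move=> j; exact: (H j).1.
split=> //; rewrite wtilde_affine //; congr (_ + _).
by apply: eq_bigr => j _; exact: (H j).2.
Qed.

Let vertex_worst : Pbox kappa vertex /\ wtilde R X mb vertex kappa = worst.
Proof.
apply/wtilde_eq_worst => j; rewrite mxE.
by case: (ltgtP (slope j) 0) => // _; split=> // _; rewrite lexx Pcap_ge0.
Qed.

(** Since [vertex] attains the upper bound [worst], the maximizers are exactly the points of the box
    with value [worst]. *)
Lemma maximizer_wtildeP (p : 'cV[F]_n) :
  maximizer (Pbox kappa) (fun q : 'cV[F]_n => wtilde R X mb q kappa) p <->
  forall j, [/\ 0 < slope j -> p j 0 = Pcap kappa j,
                slope j < 0 -> p j 0 = 0
              & slope j = 0 -> 0 <= p j 0 <= Pcap kappa j].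
Proof.
have [vP vE] := vertex_worst.
split=> [[pP pmax]|/wtilde_eq_worst[pP pE]].
  apply/wtilde_eq_worst; split=> //; apply/eqP; rewrite eq_le.
  by rewrite wtilde_le_worst //= -vE pmax.
by split=> // q qP; rewrite pE wtilde_le_worst.
Qed.

Lemma ImaxE :
  Imax R X mb kappa = l1norm mb + \sum_j pospart (slope j) * Pcap kappa j.
Proof.
have [vP vE] := vertex_worst.
rewrite /Imax (@max_overE _ _ _ _ vertex) //.
by split=> // q qP; rewrite vE wtilde_le_worst.
Qed.

End WorstCase.

Theorem proposition2 (F : realType) (n : nat) (hn : (1 <= n)%N)
    (R X : 'M[F]_n) (mlo mhi mb alpha : 'cV[F]_n)
    (hm0 : forall i, mlo i 0 <= 0 <= mhi i 0)
    (hmb : forall i, mlo i 0 <= mb i 0 <= mhi i 0)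
    (halpha : forall i, 0 < alpha i 0 <= 1)
    (kappa : 'cV[F]_n) (hkappa : Kbullet R X mlo mhi mb alpha kappa) :
  let sigma := sigma_vec R mb in
  let omega := omega_vec X mb in
  Imax R X mb kappa =
    l1norm mb +
    \sum_(i < n) pospart (sigma i 0 + omega i 0 * kappa i 0)
                 / Num.sqrt (1 + kappa i 0 ^+ 2)
  /\
  forall pwc : 'cV[F]_n,
    maximizer (Pbox kappa) (fun p : 'cV[F]_n => wtilde R X mb p kappa) pwc <->
    forall i : 'I_n,
      [/\ 0 < sigma i 0 + omega i 0 * kappa i 0 ->
            pwc i 0 = 1 / Num.sqrt (1 + kappa i 0 ^+ 2),
          sigma i 0 + omega i 0 * kappa i 0 < 0 -> pwc i 0 = 0
        & sigma i 0 + omega i 0 * kappa i 0 = 0 ->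
            0 <= pwc i 0 <= 1 / Num.sqrt (1 + kappa i 0 ^+ 2)].
Proof.
case: hkappa => _ box_closure sigma omega; split.
  by rewrite ImaxE //; congr (_ + _); apply: eq_bigr => i _; rewrite /Pcap div1r.
by move=> pwc; exact: maximizer_wtildeP.
Qed.
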